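(* Let $\{X_i : i\in I\}$ be a family of separable almost-CL-spaces, and let $X = [\bigoplus_{i\in I} X_i]_{c_0}$ or $X = [\bigoplus_{i\in I} X_i]_{\ell_1}$. Then $X$ has the Mazur-Ulam property.
   Context: All spaces are over the real field. For a Banach space $X$, $B_X$ and $S_X$ are its closed unit ball and unit sphere. A convex subset $C$ of $S_X$ is a maximal convex subset of $S_X$ if it is not properly contained in any other convex subset of $S_X$. A Banach space $X$ is an almost-CL-space if for every maximal convex subset $C$ of $S_X$ one has $B_X=\overline{\mathrm{co}}(C\cup -C)$ (closed convex hull). $[\bigoplus_{i\in I} X_i]_{c_0}$ is the $c_0$-sum of the family: all $(x_i)_{i\in I}$ with $x_i\in X_i$ and $(\|x_i\|)_{i\in I}\in c_0(I)$, with norm $\sup_i\|x_i\|$. $[\bigoplus_{i\in I} X_i]_{\ell_1}$ is the $\ell_1$-sum: all $(x_i)_{i\in I}$ with $x_i\in X_i$ and $\sum_i\|x_i\|<\infty$, with norm $\sum_i\|x_i\|$. A Banach space $X$ has the Mazur-Ulam property (MUP) if for every Banach space $Y$, every surjective isometry $T:S_X\to S_Y$ between the unit spheres is the restriction of a linear isometry between the two spaces $X$ and $Y$. *)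

(* Defs.v *)
From HB Require Import structures.
From mathcomp Require Import all_boot all_order all_algebra finmap.
From mathcomp Require Import lra.
From mathcomp Require Import all_classical all_reals.
From mathcomp Require Import interval_inference ereal topology normedtype.
From mathcomp Require Import sequences esum convex.

Set Implicit Arguments.
Unset Strict Implicit.
Unset Printing Implicit Defensive.

Import Order.TTheory GRing.Theory Num.Theory.
Import numFieldNormedType.Exports.

Local Open Scope classical_set_scope.
Local Open Scope ring_scope.

Definition separable (T : topologicalType) : Prop :=
  exists2 D : set T, countable D & dense D.

Section Geometry.
Context {R : realType}.

Definition unit_sphere (X : normedModType R) : set X := [set x | `|x| = 1].

Definition unit_ball (X : normedModType R) : set X := [set x | `|x| <= 1].

Definition maximal_convex_subset (X : normedModType R) (S C : set X) : Prop :=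
  [/\ C `<=` S, convex_set C &
      forall D : set X, D `<=` S -> convex_set D -> C `<=` D -> D = C].

Definition convex_hull (X : normedModType R) (A : set X) : set X :=
  smallest (@convex_set R X) A.

(* For X = 0 the unit sphere is empty and set0 is a maximal convex subset of it,
   so the trivial space is not almost-CL. *)
Definition almost_CL_space (X : normedModType R) : Prop :=
  forall C : set X, maximal_convex_subset (@unit_sphere X) C ->
    @unit_ball X = closure (convex_hull (C `|` [set - x | x in C])).

(* A map between the spheres is represented by a total map T : X -> Y of which
   only the values on the unit sphere of X are constrained and used. *)
Definition Mazur_Ulam_property (X : completeNormedModType R) : Prop :=
  forall (Y : completeNormedModType R) (T : X -> Y),
    T @` @unit_sphere X = @unit_sphere Y ->
    (forall x y, unit_sphere x -> unit_sphere y -> `|T x - T y| = `|x - y|) ->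
    exists L : {linear X -> Y},
      [/\ forall x, `|L x| = `|x|, set_surj setT setT L &
          forall x, unit_sphere x -> T x = L x].

End Geometry.

(* The vector space of all families (x_i)_i with x_i in X_i. *)
Definition family (R : realType) (I : choiceType)
  (X : I -> completeNormedModType R) : Type := forall i, X i.

Section Family.
Context {R : realType} {I : choiceType} (X : I -> completeNormedModType R).
Implicit Types x y z : family X.

HB.instance Definition _ := Choice.copy (family X) (forall i, X i).

Let add x y : family X := fun i => x i + y i.
Let opp x : family X := fun i => - x i.
Let scale (k : R) x : family X := fun i => k *: x i.

Let addA : associative add.
Proof. by move=> x y z; apply: functional_extensionality_dep => i; exact: addrA. Qed.
Let addC : commutative add.
Proof. by move=> x y; apply: functional_extensionality_dep => i; exact: addrC. Qed.
Let add0 : left_id (fun i => 0 : X i) add.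
Proof. by move=> x; apply: functional_extensionality_dep => i; exact: add0r. Qed.
Let addN : left_inverse (fun i => 0 : X i) opp add.
Proof. by move=> x; apply: functional_extensionality_dep => i; exact: addNr. Qed.

HB.instance Definition _ :=
  GRing.isZmodule.Build (family X) addA addC add0 addN.

Let scaleA k l x : scale k (scale l x) = scale (k * l) x.
Proof. by apply: functional_extensionality_dep => i; exact: scalerA. Qed.
Let scale1 : left_id 1 scale.
Proof. by move=> x; apply: functional_extensionality_dep => i; exact: scale1r. Qed.
Let scaleDr : right_distributive scale +%R.
Proof. by move=> k x y; apply: functional_extensionality_dep => i; exact: scalerDr. Qed.
Let scaleDl x : {morph scale^~ x : k l / k + l}.
Proof. by move=> k l; apply: functional_extensionality_dep => i; exact: scalerDl. Qed.

HB.instance Definition _ := GRing.Zmodule_isLmodule.Build R (family X)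
  scaleA scale1 scaleDr scaleDl.

Lemma familyD x y i : (x + y) i = x i + y i. Proof. by []. Qed.
Lemma familyN x i : (- x) i = - x i. Proof. by []. Qed.
Lemma family0 i : (0 : family X) i = 0. Proof. by []. Qed.
Lemma familyZ k x i : (k *: x) i = k *: x i. Proof. by []. Qed.

End Family.

(* A normed space E of families is complete as soon as coordinates are
   1-Lipschitz, its closed balls are closed under coordinatewise convergence,
   and a family that is, for every e, a coordinatewise limit of points of some
   ball of radius e belongs to E. *)
Section Completeness.
Context {R : realType} {I : choiceType} (X : I -> completeNormedModType R).
Context (E : normedModType R) (f : E -> family X).

Definition approximable (l : family X) (x : E) (e : R) : Prop :=
  forall (J : {fset I}) (d : R), 0 < d ->
    exists2 y : E, `|x - y| <= e & forall i, i \in J -> `|f y i - l i| <= d.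

Hypothesis fB : forall x y i, f (x - y) i = f x i - f y i.
Hypothesis f_le : forall x i, `|f x i| <= `|x|.
Hypothesis f_closed : forall x z e, approximable (f z) x e -> `|x - z| <= e.
Hypothesis f_mem : forall l,
  (forall e, 0 < e -> exists x, approximable l x e) -> exists z, f z = l.

Lemma family_complete (F : set_system E) : ProperFilter F -> cauchy F -> cvg F.
Proof.
move=> FF Fc.
have Fi i : exists l : X i, (fun x => f x i) @ F --> l.
  apply/cvg_ex; apply/cauchy_cvgP/cauchyP => _/posnumP[e].
  have /cauchyP/(_ e%:num (gt0 e))[x Fx] := Fc.
  exists (f x i); rewrite /fmap/=; apply: filterS Fx => y.
  rewrite -!ball_normE/=; apply: le_lt_trans.
  by have := f_le (x - y) i; rewrite fB.
pose l : family X := fun i => projT1 (cid (Fi i)).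
have Fl i : (fun x => f x i) @ F --> l i by rewrite /l; case: cid.
have F_app x e : F (ball x e) -> approximable l x e.
  move=> Fx J d d0.
  have FJ : F (\bigcap_(i in [set i | i \in J])
      [set y | `|l i - f y i| <= d]).
    by apply: filter_bigI => i _; have /cvgrPdist_le/(_ _ d0) := Fl i.
  have [y [xy yJ]] := filter_ex (filterI Fx FJ).
  exists y; first by move: xy; rewrite -ball_normE => /ltW.
  by move=> i iJ; rewrite distrC; exact: yJ.
have Fe e : 0 < e -> exists x, F (ball x e).
  by move=> e0; have /cauchyP/(_ e e0) := Fc.
have [z fz] : exists z, f z = l.
  by apply: f_mem => e /Fe[x /F_app]; exists x.
apply/cvg_ex; exists z; apply/cvgrPdist_le => e e0.
have e2 : 0 < e / 2 by rewrite divr_gt0.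
have [x Fx] := Fe _ e2.
have xz : `|x - z| <= e / 2.
  by apply: f_closed; rewrite fz; exact: F_app.
rewrite near_simpl; apply: filterS Fx => y; rewrite -ball_normE/= => /ltW xy.
rewrite (splitr e) -(subrK x z) -addrA (le_trans (ler_normD _ _))//.
by rewrite lerD// distrC.
Qed.

End Completeness.

Section C0Sum.
Context {R : realType} {I : choiceType} (X : I -> completeNormedModType R).

(* Over an arbitrary index set, (|x_i|)_i belongs to c_0(I) when |x_i| >= e holds
   for only finitely many i, for every e > 0. *)
Definition c0_pred : {pred family X} := fun x =>
  `[< forall e : R, 0 < e -> finite_set [set i | e <= `|x i|] >].

Lemma c0_submod : submod_closed c0_pred.
Proof.
split.
  apply/asboolP => e e0; rewrite (_ : [set _ | _] = set0)//.
  by apply/seteqP; split => // i /=; rewrite family0 normr0 leNgt e0.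
move=> k x y /asboolP xc /asboolP yc; apply/asboolP => e e0.
have e2 : 0 < e / 2 by rewrite divr_gt0.
have k1 : 0 < `|k| + 1 by rewrite ltr_wpDl.
apply: (@sub_finite_set _ _ ([set i | e / 2 / (`|k| + 1) <= `|x i|] `|`
                             [set i | e / 2 <= `|y i|])).
  move=> i /=; rewrite familyD familyZ => exy; apply: contrapT => /not_orP[].
  move=> /negP; rewrite -ltNge ltr_pdivlMr// => xi /negP; rewrite -ltNge => yi.
  move: exy; apply/negP; rewrite -ltNge (le_lt_trans (ler_normD _ _))//.
  rewrite [ltRHS]splitr ltrD// normrZ (le_lt_trans _ xi)// mulrC.
  by rewrite ler_wpM2l// lerDl.
by rewrite finite_setU; split; [apply: xc; rewrite divr_gt0|exact: yc].
Qed.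

HB.instance Definition _ := GRing.isSubmodClosed.Build R (family X) c0_pred c0_submod.

Record c0_sum := C0Sum { c0_val : family X ; c0_valP : c0_val \in c0_pred }.

HB.instance Definition _ := [isSub for c0_val].
HB.instance Definition _ := [Choice of c0_sum by <:].
HB.instance Definition _ := [SubChoice_isSubLmodule of c0_sum by <:].

Implicit Types x y : c0_sum.

Lemma c0_valD x y i : c0_val (x + y) i = c0_val x i + c0_val y i.
Proof. by []. Qed.
Lemma c0_valN x i : c0_val (- x) i = - c0_val x i.
Proof. by []. Qed.
Lemma c0_valZ (k : R) x i : c0_val (k *: x) i = k *: c0_val x i.
Proof. by []. Qed.

Definition c0_norm x : R := sup (range (fun i => `|c0_val x i|)).

Let c0P x (e : R) : 0 < e -> finite_set [set i | e <= `|c0_val x i|].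
Proof. by have /asboolP := c0_valP x; exact. Qed.

Let c0_ub x : has_ubound (range (fun i => `|c0_val x i|)).
Proof.
have fin := c0P x (@ltr01 R).
exists (\sum_(i <- fset_set [set i | 1 <= `|c0_val x i|]) `|c0_val x i| + 1) => _ [i _ <-].
have [x1|/ltW x1] := leP 1 `|c0_val x i|; last first.
  by rewrite (le_trans x1)// lerDr sumr_ge0.
have iJ : i \in fset_set [set i | 1 <= `|c0_val x i|] by rewrite in_fset_set// inE.
rewrite (big_fsetD1 i)//= -addrA lerDl addr_ge0//.
by rewrite big_seq sumr_ge0.
Qed.

Let c0_le x i : `|c0_val x i| <= c0_norm x.
Proof. by apply: ub_le_sup; [exact: c0_ub|exists i]. Qed.

Let c0_norm_sup0 x : (I -> False) -> c0_norm x = 0.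
Proof.
move=> I0; rewrite /c0_norm [X in sup X](_ : _ = set0) ?sup0//.
by rewrite -subset0 => r [i _]; have := I0 i.
Qed.

Let c0_lub x (M : R) :
  0 <= M -> (forall i, `|c0_val x i| <= M) -> c0_norm x <= M.
Proof.
move=> M0 xM; have [[i _]|I0] := pselect (exists i : I, True).
  by apply: ge_sup => [|_ [j _ <-]//]; exists `|c0_val x i|, i.
by rewrite c0_norm_sup0// => i; apply: I0; exists i.
Qed.

Let c0_norm_ge0 x : 0 <= c0_norm x.
Proof.
have [[i _]|I0] := pselect (exists i : I, True).
  exact: le_trans (c0_le x i).
by rewrite c0_norm_sup0// => i; apply: I0; exists i.
Qed.

Let c0_normD x y : c0_norm (x + y) <= c0_norm x + c0_norm y.
Proof.
apply: c0_lub => [|i]; first exact: addr_ge0.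
rewrite c0_valD; apply: le_trans (ler_normD _ _) _.
by apply: lerD; exact: c0_le.
Qed.

Let c0_normZ (k : R) x : c0_norm (k *: x) = `|k| * c0_norm x.
Proof.
have le_ l z : c0_norm (l *: z) <= `|l| * c0_norm z.
  apply: c0_lub => [|i]; first by rewrite mulr_ge0// c0_norm_ge0.
  by rewrite c0_valZ normrZ ler_wpM2l// c0_le.
have [->|k0] := eqVneq k 0.
  apply/eqP; rewrite normr0 mul0r eq_le c0_norm_ge0 andbT.
  by rewrite (le_trans (le_ _ _))// normr0 mul0r.
apply/eqP; rewrite eq_le le_/= -ler_pdivlMl ?normr_gt0//.
by rewrite -normfV (le_trans _ (le_ _ _))// scalerA mulVf// scale1r.
Qed.

Let c0_norm0_eq0 x : c0_norm x = 0 -> x = 0.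
Proof.
move=> x0; apply: val_inj; apply: functional_extensionality_dep => i.
by apply/normr0_eq0/eqP; rewrite eq_le normr_ge0 andbT -x0; exact: c0_le.
Qed.

HB.instance Definition _ := Lmodule_isNormed.Build R c0_sum
  c0_normD c0_normZ c0_norm0_eq0.

Let c0_closed x z (e : R) : approximable (@c0_val) (c0_val z) x e -> `|x - z| <= e.
Proof.
move=> xz; have [y xy _] := xz fset0 1 ltr01.
apply: c0_lub => [|i]; first exact: le_trans xy.
apply/ler_addgt0Pr => d d0; have {xy}[{}y xy yz] := xz [fset i]%fset d d0.
rewrite c0_valD c0_valN -(subrK (c0_val y i) (c0_val x i)) -addrA (le_trans (ler_normD _ _))//.
rewrite lerD//; last by rewrite yz// inE.
by rewrite (le_trans (c0_le (x - y) i)).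
Qed.

Let c0_mem l : (forall e : R, 0 < e -> exists x, approximable (@c0_val) l x e) ->
  exists z : c0_sum, c0_val z = l.
Proof.
move=> lx; suff lc : l \in c0_pred by exists (C0Sum lc).
apply/asboolP => e e0; have e3 : 0 < e / 3 by rewrite divr_gt0.
have [x xl] := lx _ e3; apply: sub_finite_set (c0P x e3) => i /= li.
have [y xy yl] := xl [fset i]%fset _ e3.
have {}yl : `|c0_val y i - l i| <= e / 3 by rewrite yl// inE.
have {}xy : `|c0_val x i - c0_val y i| <= e / 3 by apply: le_trans xy; exact: c0_le (x - y) i.
have {}li : e <= `|c0_val y i| + e / 3.
  rewrite (le_trans li)// -[l i](subKr (c0_val y i)) (le_trans (ler_normB _ _))//.
  by rewrite lerD2l.
have : `|c0_val y i| <= `|c0_val x i| + e / 3.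
  rewrite -[c0_val y i](subKr (c0_val x i)) (le_trans (ler_normB _ _))//.
  by rewrite lerD2l.
lra.
Qed.

HB.instance Definition _ := Uniform_isComplete.Build c0_sum
  (family_complete (fun _ _ _ => erefl) c0_le c0_closed c0_mem).

End C0Sum.

Section L1Sum.
Context {R : realType} {I : choiceType} (X : I -> completeNormedModType R).

Definition l1_pred : {pred family X} := fun x =>
  summable [set: I] (fun i => `|x i|%:E).

Let l1_predP (x : family X) :
  (x \in l1_pred) = (\esum_(i in [set: I]) `|x i|%:E < +oo)%E.
Proof.
rewrite -[LHS]/(summable _ _) /summable; congr (_ < _)%E.
by apply: eq_esum => i _; rewrite gee0_abs.
Qed.

Let l1_esum_le (x : family X) (M : R) :
  (forall J : {fset I}, \sum_(i <- J) `|x i| <= M) ->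
  (\esum_(i in [set: I]) `|x i|%:E <= M%:E)%E.
Proof.
move=> xM; apply: ge_ereal_sup => _ [A [fA _] <-].
by rewrite fsbig_finite// sumEFin lee_fin.
Qed.

Let l1_esum_ge (x : family X) (J : {fset I}) :
  ((\sum_(i <- J) `|x i|)%:E <= \esum_(i in [set: I]) `|x i|%:E)%E.
Proof.
apply: ereal_sup_ubound; exists [set` J]; first by split.
by rewrite fsbig_finite// set_fsetK sumEFin.
Qed.

Let l1_esumE (x : family X) : x \in l1_pred ->
  \esum_(i in [set: I]) `|x i|%:E =
  (fine (\esum_(i in [set: I]) `|x i|%:E))%:E.
Proof.
rewrite l1_predP => xoo; rewrite fineK// ge0_fin_numE//.
exact: esum_ge0.
Qed.

Lemma l1_predPfset (x : family X) : x \in l1_pred <->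
  exists M : R, forall J : {fset I}, \sum_(i <- J) `|x i| <= M.
Proof.
split=> [xl|[M xM]]; last first.
  by rewrite l1_predP (le_lt_trans (l1_esum_le xM))// ltry.
exists (fine (\esum_(i in [set: I]) `|x i|%:E)) => J.
by rewrite -lee_fin -l1_esumE// l1_esum_ge.
Qed.

Lemma l1_submod : submod_closed l1_pred.
Proof.
split.
  by apply/l1_predPfset; exists 0 => J; rewrite big1// => i _; rewrite family0 normr0.
move=> k x y /l1_predPfset[M xM] /l1_predPfset[N yN]; apply/l1_predPfset.
exists (`|k| * M + N) => J.
apply: (@le_trans _ _ (`|k| * (\sum_(i <- J) `|x i|) + \sum_(i <- J) `|y i|)).
  rewrite mulr_sumr -big_split/=; apply: ler_sum => i _.
  by rewrite familyD familyZ -normrZ ler_normD.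
by rewrite lerD// ler_wpM2l.
Qed.

HB.instance Definition _ := GRing.isSubmodClosed.Build R (family X) l1_pred l1_submod.

Record l1_sum := L1Sum { l1_val : family X ; l1_valP : l1_val \in l1_pred }.

HB.instance Definition _ := [isSub for l1_val].
HB.instance Definition _ := [Choice of l1_sum by <:].
HB.instance Definition _ := [SubChoice_isSubLmodule of l1_sum by <:].

Implicit Types x y : l1_sum.

Lemma l1_valD x y i : l1_val (x + y) i = l1_val x i + l1_val y i.
Proof. by []. Qed.
Lemma l1_valN x i : l1_val (- x) i = - l1_val x i.
Proof. by []. Qed.
Lemma l1_valZ (k : R) x i : l1_val (k *: x) i = k *: l1_val x i.
Proof. by []. Qed.

Definition l1_norm x : R := fine (\esum_(i in [set: I]) `|l1_val x i|%:E).

Let l1_lub x (M : R) :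
  (forall J : {fset I}, \sum_(i <- J) `|l1_val x i| <= M) -> l1_norm x <= M.
Proof.
by move=> xM; rewrite -lee_fin -l1_esumE ?l1_valP//; exact: l1_esum_le.
Qed.

Let l1_ge x (J : {fset I}) : \sum_(i <- J) `|l1_val x i| <= l1_norm x.
Proof. by rewrite -lee_fin -l1_esumE ?l1_valP//; exact: l1_esum_ge. Qed.

Let l1_le x i : `|l1_val x i| <= l1_norm x.
Proof. by have := l1_ge x [fset i]%fset; rewrite big_seq_fset1. Qed.

Let l1_norm_ge0 x : 0 <= l1_norm x.
Proof. by have := l1_ge x fset0; rewrite big_seq_fset0. Qed.

Let l1_normD x y : l1_norm (x + y) <= l1_norm x + l1_norm y.
Proof.
apply: l1_lub => J; apply: le_trans (lerD (l1_ge x J) (l1_ge y J)).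
by rewrite -big_split; apply: ler_sum => i _; rewrite l1_valD; exact: ler_normD.
Qed.

Let l1_normZ (k : R) x : l1_norm (k *: x) = `|k| * l1_norm x.
Proof.
have le_ l z : l1_norm (l *: z) <= `|l| * l1_norm z.
  apply: l1_lub => J; apply: le_trans (ler_wpM2l (normr_ge0 l) (l1_ge z J)).
  by rewrite mulr_sumr; apply: ler_sum => i _; rewrite l1_valZ normrZ.
have [->|k0] := eqVneq k 0.
  apply/eqP; rewrite normr0 mul0r eq_le l1_norm_ge0 andbT.
  by rewrite (le_trans (le_ _ _))// normr0 mul0r.
apply/eqP; rewrite eq_le le_/= -ler_pdivlMl ?normr_gt0//.
by rewrite -normfV (le_trans _ (le_ _ _))// scalerA mulVf// scale1r.
Qed.

Let l1_norm0_eq0 x : l1_norm x = 0 -> x = 0.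
Proof.
move=> x0; apply: val_inj; apply: functional_extensionality_dep => i.
by apply/normr0_eq0/eqP; rewrite eq_le normr_ge0 andbT -x0; exact: l1_le.
Qed.

HB.instance Definition _ := Lmodule_isNormed.Build R l1_sum
  l1_normD l1_normZ l1_norm0_eq0.

Let l1_approx (l : family X) x (e : R) (J : {fset I}) :
  approximable (@l1_val) l x e -> \sum_(i <- J) `|l1_val x i - l i| <= e.
Proof.
move=> xl; apply/ler_addgt0Pr => d d0.
pose c : R := (size J).+1%:R.
have c0 : 0 < c by rewrite ltr0n.
have [y xy yl] := xl J (d / c) (divr_gt0 d0 c0).
apply: (@le_trans _ _ (\sum_(i <- J) `|l1_val (x - y) i| + \sum_(i <- J) d / c)).
  rewrite -big_split !big_seq; apply: ler_sum => i iJ.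
  rewrite l1_valD l1_valN -(subrKA (l1_val y i)) (le_trans (ler_normD _ _))//.
  by rewrite lerD2l yl.
rewrite lerD//; first exact: le_trans (l1_ge _ _) xy.
rewrite big_const_seq iter_addr_0 count_predT -mulr_natr mulrAC.
by rewrite ler_pdivrMr// (ler_wpM2l (ltW d0))// /c ler_nat.
Qed.

Let l1_closed x z (e : R) : approximable (@l1_val) (l1_val z) x e -> `|x - z| <= e.
Proof. by move=> xz; apply: l1_lub => J; exact: l1_approx. Qed.

Let l1_mem l :
  (forall e : R, 0 < e -> exists x, approximable (@l1_val) l x e) ->
  exists z : l1_sum, l1_val z = l.
Proof.
move=> /(_ 1 ltr01)[x xl].
suff ll : l \in l1_pred by exists (L1Sum ll).
apply/l1_predPfset; exists (l1_norm x + 1) => J.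
apply: le_trans (lerD (l1_ge x J) (l1_approx J xl)).
rewrite -big_split/=; apply: ler_sum => i _.
by rewrite -[l i](subKr (l1_val x i)) (le_trans (ler_normB _ _))// subKr.
Qed.

HB.instance Definition _ := Uniform_isComplete.Build l1_sum
  (family_complete (fun _ _ _ => erefl) l1_le l1_closed l1_mem).

End L1Sum.

(* Main.v *)
From HB Require Import structures.
Require Import Defs.
From mathcomp Require Import all_boot all_order all_algebra finmap.
From mathcomp Require Import ring lra.
From mathcomp Require Import all_classical all_reals.
From mathcomp Require Import interval_inference ereal topology normedtype.
From mathcomp Require Import esum convex.

(** A surjective isometry T : S_X -> S_Y of unit spheres knows which pairs of
    points lie on a common segment of the sphere: |x + y| = 2 if and only if
    |T x + T y| = 2 ([sphere_isometry_star]).  The theorem holds because the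
    spheres at hand carry many convex subsets C that are large in the following
    sense: every y in the sphere has c and c' in C with |y - c| + |y + c'| as
    close as desired to 2, the least possible value.  A functional f of norm 1
    equal to 1 on C is then determined by distances, since
    1 - |y - c| <= f y <= |y + c'| - 1, and T preserves distances.  A space is
    called facially lush below when every unit vector is close to such a C.

    An almost-CL-space is facially lush: take for C a maximal convex subset of
    the sphere through the given vector.  The points h having c, c' in C with
    |h - c| + |h + c'| <= 2 form a convex set containing C and -C, hence come
    arbitrarily close to every vector of the ball ([almost_CL_facially_lush]).  Facial lushness passes to
    both sums: in the c_0-sum a large set of one factor is pulled back along the
    coordinate, and in the l_1-sum one takes the vectors of norm 1 whose i-th
    coordinate lies in the cone over a large set C_i
    ([c0_sum_facially_lush], [l1_sum_facially_lush]).

    It remains to extend T linearly when X is facially lush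
    ([facially_lush_Mazur_Ulam]).  Let F be the positively homogeneous extension
    of T; it preserves the norm and is onto, so only additivity is at stake.
    Instead of a functional f equal to 1 on C and its counterpart on Y, the
    argument uses one-sided derivatives of the norm.  For finitely many
    points of C, a point m of C is chosen in the middle of them; its image T m
    can be completed to a unit vector w in the middle of the images T c and of
    the vectors - T (- c) ([sphere_isometry_center]).  The derivatives of the
    norms at m along x and at w along F x then both agree, up to a small error,
    with 1 - |x - c| for unit vectors x, c being a point of C attached to x
    ([homogeneous_extension_slopes]).
    Derivatives of a norm are sublinear, and here they are nearly odd, hence
    nearly additive on the chosen points.  If F (x + y) - F x - F y were a
    nonzero vector F z, then the derivative along it at w would be close to 0 by
    this near additivity, and at least |z| / 2 as soon as C passes within 1 / 2
    of the direction of z: a contradiction ([homogeneous_extensionD]). *)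

Set Implicit Arguments.
Unset Strict Implicit.
Unset Printing Implicit Defensive.

Import Order.TTheory GRing.Theory Num.Theory.
Import numFieldNormedType.Exports.

Local Open Scope classical_set_scope.
Local Open Scope ring_scope.

(** * Large convex subsets of the sphere *)

Section FacialLushness.
Context {R : realType}.
Implicit Type X : normedModType R.

Lemma convex_setE X (C : set X) : convex_set C <->
  forall x y (a b : R), C x -> C y -> 0 <= a -> 0 <= b -> a + b = 1 ->
    C (a *: x + b *: y).
Proof.
split=> [cC x y a b Cx Cy a0 b0 ab1|cC x y l /set_mem Cx /set_mem Cy].
  have a1 : a <= 1 by rewrite -ab1 lerDl.
  have := cC _ _ (Itv01 a0 a1) (mem_set Cx) (mem_set Cy) => /set_mem.
  by have -> : b = 1 - a; [rewrite -ab1 addrAC subrr add0r|].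
by apply/mem_set/cC => //; rewrite /= ?subr_ge0// subrKC.
Qed.

Lemma normr_normalize X (x : X) : x != 0 -> `| `|x|^-1 *: x| = 1.
Proof. by move=> x0; rewrite normrZ normfV normr_id mulVf ?normr_eq0. Qed.

(** A variant of lushness and of generalized lushness in which slices of the
    ball are replaced by convex subsets of the sphere itself. *)
Definition facially_lush X : Prop :=
  forall (x : X) (e : R), unit_sphere x -> 0 < e -> exists C : set X,
    [/\ convex_set C, C `<=` @unit_sphere R X,
        exists2 c, C c & `|x - c| <= e &
        forall (y : X) (d : R), unit_sphere y -> 0 < d ->
          exists c c', [/\ C c, C c' & `|y - c| + `|y + c'| <= 2 + d]].

Lemma sub_maximal_convex_subset X (S C : set X) : C `<=` S -> convex_set C ->
  exists2 D, maximal_convex_subset S D & C `<=` D.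
Proof.
move=> CS cC.
(* Asking for D `|` C rather than D makes the union of the empty chain
   admissible. *)
pose P (D : set X) := D `|` C `<=` S /\ convex_set (D `|` C).
have [D [[DS cD] Dmax]] : exists D, P D /\ forall E, D `<` E -> ~ P E.
  apply: Zorn_bigcup => F FP Ftot; split.
    by move=> x [[D FD Dx]|/CS//]; have [DS _] := FP _ FD; apply: DS; left.
  apply/convex_setE => x y a b Ux Uy a0 b0 ab1.
  have UU x' y' D : F D -> (D `|` C) x' -> (D `|` C) y' ->
      (\bigcup_(E in F) E `|` C) (a *: x' + b *: y').
    move=> FD Dx Dy; have [_ /convex_setE cD] := FP _ FD.
    by have [] := cD _ _ _ _ Dx Dy a0 b0 ab1; [left; exists D|right].
  case: Ux Uy => [[D FD Dx]|Cx] [[E FE Ey]|Cy].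
  - have [DE|ED] := Ftot _ _ FD FE.
      by apply: (UU _ _ E) => //; left => //; exact: DE.
    by apply: (UU _ _ D) => //; left => //; exact: ED.
  - by apply: (UU _ _ D) => //; [left|right].
  - by apply: (UU _ _ E) => //; [right|left].
  - by right; move/convex_setE : cC; apply.
have DCD : D `|` C = D.
  apply: contrapT => nDC; apply: (Dmax (D `|` C)).
    by split; [left|move=> DC; apply: nDC; apply/seteqP; split => // x; left].
  by rewrite /P -setUA setUid.
exists D; last by rewrite -DCD; right.
split; [by rewrite -DCD|by rewrite -DCD|] => E ES cE DE.
apply: contrapT => nED; apply: (Dmax E).
  by split=> // ED; apply: nED; apply/seteqP.
have CE : C `<=` E by apply: subset_trans DE; rewrite -DCD; right.
by rewrite /P (setUidPl _ _).2.
Qed.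

(** The set G of the proof is convex because |h - c| + |h + c'| is a convex
    function of (h, c, c'). *)
Lemma almost_CL_facially_lush X : almost_CL_space X -> facially_lush X.
Proof.
move=> XCL x e xS e0.
have [||D maxD xD] := @sub_maximal_convex_subset X (@unit_sphere R X) [set x].
- by move=> _ ->.
- apply/convex_setE => _ _ a b -> -> _ _ ab1.
  by rewrite -scalerDl ab1 scale1r.
have [DS cD _] := maxD; exists D; split=> //.
  by exists x; [exact: xD|rewrite subrr normr0 ltW].
move=> y d yS d0.
pose G := [set h : X | exists c c', [/\ D c, D c' & `|h - c| + `|h + c'| <= 2]].
have DG : convex_hull (D `|` [set - z | z in D]) `<=` G.
  apply: smallest_sub.
    apply/convex_setE => g h a b [c1 [c1' [Dc1 Dc1' gc]]] [c2 [c2' [Dc2 Dc2' hc]]].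
    move=> a0 b0 ab1; move/convex_setE in cD.
    exists (a *: c1 + b *: c2), (a *: c1' + b *: c2'); split; try exact: cD.
    have -> : 2 = a * 2 + b * 2 :> R by rewrite -mulrDl ab1 mul1r.
    apply: le_trans (lerD (ler_wpM2l a0 gc) (ler_wpM2l b0 hc)).
    rewrite opprD addrACA -!scalerBr [X in _ + `|X|]addrACA -!scalerDr.
    rewrite !mulrDr addrACA; apply: lerD; apply: le_trans (ler_normD _ _) _;
    by rewrite !normrZ !ger0_norm.
  have D2 z : D z -> `|z + z| = 2.
    by move=> /DS z1; rewrite -mulr2n normrMn z1.
  move=> z [Dz|[{}z Dz <-]]; exists z, z; split => //.
    by rewrite subrr normr0 add0r D2.
  by rewrite addNr normr0 addr0 -opprD normrN D2.
have : @unit_ball R X y by rewrite /unit_ball/= yS.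
rewrite (XCL _ maxD) => /(_ (ball y (d / 2))).
case=> [|h [/DG[c [c' [Dc Dc' hc]]]]].
  by apply: nbhsx_ballx; rewrite divr_gt0.
rewrite -ball_normE/= => /ltW yh; exists c, c'; split=> //.
apply: (@le_trans _ _ ((`|y - h| + `|h - c|) + (`|y - h| + `|h + c'|))).
  apply: lerD; first exact: ler_distD.
  by rewrite -[y + c'](subrKA h) ler_normD.
by rewrite addrACA; lra.
Qed.

End FacialLushness.

(** Shrinking y towards 0 moves |y - c| + |y + c'| towards |c| + |c'| = 2. *)
Lemma facially_lush_ball (R : realType) (Z : normedModType R) (C : set Z) (c0 : Z) :
  C `<=` @unit_sphere R Z -> C c0 ->
  (forall (y : Z) (d : R), unit_sphere y -> 0 < d ->
    exists c c', [/\ C c, C c' & `|y - c| + `|y + c'| <= 2 + d]) ->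
  forall (y : Z) (d : R), `|y| <= 1 -> 0 < d ->
    exists c c', [/\ C c, C c' & `|y - c| + `|y + c'| <= 2 + d].
Proof.
move=> CS Cc0 lush y d y1 d0; have [->|yn0] := eqVneq y 0.
  exists c0, c0; split=> //; rewrite sub0r add0r normrN (CS _ Cc0).
  by have := ltW d0; lra.
have [c [c' [Cc Cc' cc']]] := lush _ d (normr_normalize yn0) d0.
exists c, c'; split=> //; set u := _ *: y in cc'.
have yu : y = `|y| *: u by rewrite scalerA mulfV ?normr_eq0// scale1r.
have contract v : C v \/ C (- v) -> `|y + v| <= `|y| * `|u + v| + (1 - `|y|).
  move=> Cv; have v1 : `|v| = 1 by case: Cv => /CS//; rewrite /unit_sphere/= normrN.
  have -> : y + v = `|y| *: (u + v) + (1 - `|y|) *: v.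
    by rewrite scalerDr -yu scalerBl scale1r -addrA subrKC.
  rewrite (le_trans (ler_normD _ _))// !normrZ normr_id v1 mulr1.
  by rewrite [ `|1 - _|]ger0_norm// subr_ge0.
have := contract (- c); rewrite opprK => /(_ (or_intror Cc)).
have := contract c' (or_introl Cc').
have := ler_wpM2l (normr_ge0 y) cc'.
have : `|y| * d <= d by rewrite ler_piMl// ltW.
lra.
Qed.

(** * One-sided derivatives of the norm *)

Section Slope.
Context {R : realType} {X : normedModType R}.
Implicit Types w x y z a b : X.

(** By convexity, |t w + y| - t decreases, as t grows, to the one-sided
    derivative of the norm at the unit vector w along y: this says that the
    derivative is at most r, and that the bound r is reached for some t. In
    particular slope_le w (- a) (- 1), for a in the ball, forces any functional
    of norm 1 equal to 1 at w to be equal to 1 at a as well. *)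
Definition slope_le w y (r : R) : Prop := exists2 t, 0 <= t & `|t *: w + y| <= t + r.

Lemma slope_le_norm w y : slope_le w y `|y|.
Proof. by exists 0; rewrite ?scale0r ?add0r. Qed.

Lemma slope_leW w y (r s : R) : r <= s -> slope_le w y r -> slope_le w y s.
Proof. by move=> rs [t t0 tr]; exists t => //; rewrite (le_trans tr)// lerD2l. Qed.

Lemma slope_leD w y z (r s : R) :
  slope_le w y r -> slope_le w z s -> slope_le w (y + z) (r + s).
Proof.
move=> [t t0 tr] [u u0 us]; exists (t + u); first exact: addr_ge0.
rewrite scalerDl addrACA (le_trans (ler_normD _ _))// addrACA.
exact: lerD.
Qed.

Lemma slope_leZ w y (k r : R) : 0 <= k -> slope_le w y r ->
  slope_le w (k *: y) (k * r).
Proof.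
move=> k0 [t t0 tr]; exists (k * t); first exact: mulr_ge0.
by rewrite -scalerA -scalerDr normrZ ger0_norm// -mulrDr ler_wpM2l.
Qed.

Lemma slope_le_dist w y z (r : R) : slope_le w y r -> slope_le w z (r + `|z - y|).
Proof.
by move=> yr; have := slope_leD yr (slope_le_norm w (z - y)); rewrite subrKC.
Qed.

Lemma slope_le0 w (r : R) : unit_sphere w -> slope_le w 0 r -> 0 <= r.
Proof.
move=> w1 [t t0]; rewrite addr0 normrZ w1 mulr1 ger0_norm//.
by rewrite lerDl.
Qed.

Lemma slope_le_refl w : slope_le w (- w) (- 1).
Proof. by exists 1 => //; rewrite scale1r !subrr normr0. Qed.

(** Together with the next lemma: averaging w with b adds b to the vectors a with
    slope_le w (- a) (- 1) and keeps the previous ones. *)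
Lemma slope_le_midl w b y (r : R) : `|b| <= 1 -> slope_le w y r ->
  slope_le (2^-1 *: (w + b)) y r.
Proof.
move=> b1 [t t0 tr]; exists (t * 2); first by rewrite mulr_ge0.
rewrite scalerA mulfK ?pnatr_eq0// scalerDr addrAC (le_trans (ler_normD _ _))//.
rewrite [t * 2]mulr_natr mulr2n addrAC; apply: lerD => //.
by rewrite normrZ ger0_norm// ler_piMr.
Qed.

Lemma slope_le_midr w b : `|w| <= 1 -> slope_le (2^-1 *: (w + b)) (- b) (- 1).
Proof.
move=> w1; exists 2 => //; rewrite scalerA mulfV ?pnatr_eq0// scale1r addrK.
by rewrite (le_trans w1)//; lra.
Qed.

(** If w is an average involving a, a segment of the sphere from z to w forces
    one from z to a, as a functional of norm 1 equal to 1 at z and w is equal to 1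
    at a. *)
Lemma slope_le_star w a z : slope_le w (- a) (- 1) -> `|z| <= 1 ->
  2 <= `|z + w| -> 2 <= `|z + a|.
Proof.
move=> [t t0 tw] z1 zw.
have t1 : 0 <= t - 1 by exact: le_trans tw.
have : t * 2 <= `|z + a| + (t - 1) + (t - 1).
  apply: le_trans (ler_wpM2l t0 zw) _; rewrite -{1}(ger0_norm t0) -normrZ.
  have -> : t *: (z + w) = (z + a) + (t - 1) *: z + (t *: w - a).
    rewrite scalerBl scale1r scalerDr (addrC z) (addrC _ (- z)) (addrA (a + z)) addrK.
    by rewrite (addrC a) addrACA subrr addr0.
  apply: le_trans (ler_normD _ _) (lerD _ tw).
  apply: le_trans (ler_normD _ _) (lerD _ _) => //.
  by rewrite normrZ ger0_norm// ler_piMr.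
lra.
Qed.

Lemma unit_sphere_mid x y : unit_sphere x -> unit_sphere y ->
  2 <= `|x + y| -> unit_sphere (2^-1 *: (x + y)).
Proof.
move=> x1 y1 xy; rewrite /unit_sphere/= normrZ ger0_norm//.
suff -> : `|x + y| = 2 by rewrite mulVf.
apply/eqP; rewrite eq_le xy andbT (le_trans (ler_normD _ _))//.
by rewrite x1 y1.
Qed.

Lemma convex_set_center (C : set X) (c0 : X) (cs : seq X) :
  convex_set C -> C `<=` @unit_sphere R X -> C c0 ->
  (forall c, c \in cs -> C c) ->
  exists2 m, C m & forall c, c \in cs -> slope_le m (- c) (- 1).
Proof.
move=> /convex_setE cC CS Cc0; elim: cs => [_|c cs IH Ccs]; first by exists c0.
have [|m Cm mcs] := IH; first by move=> b bcs; apply: Ccs; rewrite inE bcs orbT.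
have Cc : C c by apply: Ccs; rewrite mem_head.
exists (2^-1 *: (m + c)).
  by rewrite scalerDr; apply: cC => //; rewrite ?invr_ge0//; lra.
move=> b; rewrite inE => /orP[/eqP ->|bcs].
  by apply: slope_le_midr; rewrite CS.
by apply: slope_le_midl; [rewrite CS|exact: mcs].
Qed.

(** Averaging e with the points of s one after the other stays in the sphere:
    the current average w involves e, so that |w + w| = 2 gives |w + e| = 2, and
    hence |w + a| = 2 for the next point a. *)
Lemma star_center (e : X) (s : seq X) : unit_sphere e ->
  (forall a, a \in s -> unit_sphere a /\
     forall w, unit_sphere w -> 2 <= `|w + e| -> 2 <= `|w + a|) ->
  exists w, [/\ unit_sphere w, slope_le w (- e) (- 1) &
    forall a, a \in s -> slope_le w (- a) (- 1)].
Proof.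
move=> eS; elim: s => [_|a s IH es].
  by exists e; split=> //; exact: slope_le_refl.
have [|w [wS we ws]] := IH; first by move=> b bs; apply: es; rewrite inE bs orbT.
have [aS ea] := es a (mem_head _ _).
have wa : 2 <= `|w + a|.
  by apply: ea => //; apply: slope_le_star we _ _; rewrite ?wS// -mulr2n normrMn wS.
exists (2^-1 *: (w + a)); split.
- exact: unit_sphere_mid.
- by apply: slope_le_midl; rewrite ?aS.
- move=> b; rewrite inE => /orP[/eqP ->|bs].
    by apply: slope_le_midr; rewrite wS.
  by apply: slope_le_midl; [rewrite aS|exact: ws].
Qed.

End Slope.

(** * Isometries between spheres *)

Section SphereIsometry.
Context {R : realType}.

Definition sphere_isometry (X Y : normedModType R) (T : X -> Y) : Prop :=
  T @` @unit_sphere R X = @unit_sphere R Y /\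
  forall x y, unit_sphere x -> unit_sphere y -> `|T x - T y| = `|x - y|.

Context {X Y : normedModType R} (T : X -> Y).

Lemma sphere_isometry_sphere x :
  sphere_isometry T -> unit_sphere x -> unit_sphere (T x).
Proof. by move=> [TS _] xS; rewrite -TS; exists x. Qed.

Lemma sphere_isometry_inv : sphere_isometry T -> exists U : Y -> X,
  sphere_isometry U /\ (forall x, unit_sphere x -> U (T x) = x).
Proof.
move=> TI; have [TS Tiso] := TI.
have /choice[U UP] (y : Y) : exists x, unit_sphere y -> unit_sphere x /\ T x = y.
  have [yS|nyS] := pselect (unit_sphere y); last by exists 0.
  by move: (yS); rewrite -TS => -[x xS <-]; exists x.
have UT x : unit_sphere x -> U (T x) = x.
  move=> xS; have [US TU] := UP _ (sphere_isometry_sphere TI xS).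
  apply/eqP; rewrite -subr_eq0 -normr_eq0 -Tiso// TU subrr normr0//.
exists U; split=> //; split.
  apply/seteqP; split => [_ [y yS <-]|x xS]; first by have [] := UP _ yS.
  by exists (T x); [exact: sphere_isometry_sphere|exact: UT].
move=> y z yS zS; have [Uy TUy] := UP _ yS; have [Uz TUz] := UP _ zS.
by rewrite -Tiso// TUy TUz.
Qed.

(** For p on the segment from x to y, let z be the point with T z = - T p. Then
    |p - z| = |T p - T z| = 2, and p is an average involving x, so that
    |x - z| = 2, that is |T x + T p| = 2. Let p tend to y. *)
Lemma sphere_isometry_star x y : sphere_isometry T ->
  unit_sphere x -> unit_sphere y -> 2 <= `|x + y| -> 2 <= `|T x + T y|.
Proof.
move=> TI xS yS xy; have [TS Tiso] := TI.
apply/ler_addgt0Pr => e e0.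
pose s := Num.min (2^-1 : R) (e / 2).
have s0 : 0 < s by rewrite lt_min invr_gt0 ltr0n divr_gt0.
have s2 : s <= 2^-1 by rewrite ge_min lexx.
have se : s <= e / 2 by rewrite ge_min lexx orbT.
have s1 : 0 <= 1 - s by lra.
pose p := s *: x + (1 - s) *: y.
(* The lower bound for |p| holds because x + y, of norm 2, is a combination of
   p and x with positive coefficients. *)
have pS : unit_sphere p.
  apply/eqP; rewrite eq_le; apply/andP; split.
    apply: le_trans (ler_normD _ _) _.
    by rewrite !normrZ xS yS !ger0_norm ?(ltW s0)//; lra.
  have : (1 - s) * 2 <= `|p| + (1 - s - s).
    apply: le_trans (ler_wpM2l s1 xy) _.
    rewrite -{1}(ger0_norm s1) -normrZ.
    have -> : (1 - s) *: (x + y) = p + (1 - s - s) *: x.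
      by rewrite /p scalerDr addrAC -scalerDl subrKC.
    apply: le_trans (ler_normD _ _) _; rewrite lerD2l normrZ xS mulr1 ger0_norm//.
    lra.
  lra.
have px : slope_le p (- x) (- 1).
  exists s^-1; first by rewrite invr_ge0 ltW.
  rewrite /p scalerDr !scalerA mulVf ?gt_eqF// scale1r addrAC subrr add0r.
  rewrite normrZ yS mulr1 mulrBr mulr1 mulVf ?gt_eqF//.
  by rewrite ger0_norm// subr_ge0 invf_ge1//; lra.
have TpS := sphere_isometry_sphere TI pS.
have [z zS Tz] : (T @` @unit_sphere R X) (- T p).
  by rewrite TS /unit_sphere/= normrN.
have xz : 2 <= `|- z + x|.
  apply: slope_le_star px _ _; first by rewrite normrN zS.
  rewrite addrC -Tiso// Tz opprK -mulr2n normrMn.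
  by rewrite (TpS : `|_| = _).
have Txp : 2 <= `|T x + T p|.
  by rewrite -[T p]opprK -Tz Tiso// addrC.
have pe : `|T p - T y| <= e.
  rewrite Tiso// /p scalerBl scale1r addrA addrAC addrK -scalerBr normrZ gtr0_norm//.
  have : `|x - y| <= 2 by rewrite (le_trans (ler_normB _ _))// xS yS.
  move=> /(ler_wpM2l (ltW s0)); lra.
apply: le_trans Txp _; apply: le_trans (lerD (lexx _) pe).
by rewrite -[T p in leLHS](subrKC (T y)) addrA ler_normD.
Qed.

End SphereIsometry.

(** * The linear extension *)

Section Extension.
Context {R : realType}.

Definition homogeneous_extension (X Y : normedModType R) (T : X -> Y) (x : X) : Y :=
  `|x| *: T (`|x|^-1 *: x).

Context {X Y : normedModType R} (T : X -> Y).
Hypothesis TI : sphere_isometry T.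
Let F := homogeneous_extension T.

Lemma norm_homogeneous_extension x : `|F x| = `|x|.
Proof.
rewrite normrZ normr_id; have [->|x0] := eqVneq x 0; first by rewrite normr0 mul0r.
by rewrite (sphere_isometry_sphere TI (normr_normalize x0)) mulr1.
Qed.

Lemma homogeneous_extension_sphere x : unit_sphere x -> F x = T x.
Proof. by move=> xS; rewrite /F/homogeneous_extension xS invr1 !scale1r. Qed.

Lemma homogeneous_extensionZ (k : R) x : 0 <= k -> F (k *: x) = k *: F x.
Proof.
move=> k0; rewrite /F /homogeneous_extension normrZ ger0_norm// -scalerA.
have [->|kn0] := eqVneq k 0; first by rewrite !scale0r.
by congr (_ *: (_ *: T _)); rewrite scalerA invfM mulrAC mulVf// mul1r.
Qed.

Lemma homogeneous_extension_surj y : exists x, F x = y.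
Proof.
have [->|y0] := eqVneq y 0.
  by exists 0; rewrite /F /homogeneous_extension normr0 scale0r.
have [x xS Tx] : (T @` @unit_sphere R X) (`|y|^-1 *: y).
  by rewrite TI.1; exact: normr_normalize.
exists (`|y| *: x); rewrite homogeneous_extensionZ// homogeneous_extension_sphere//.
by rewrite Tx scalerA mulfV ?normr_eq0// scale1r.
Qed.

(** T m plays the part of e in [star_center]. That segments from T m extend to
    T c is transported from m and c as in [sphere_isometry_star]; that they
    extend to - T (- c) then follows from [sphere_isometry_star] applied to the
    inverse of T, which maps w to a point at distance 2 from - c as soon as
    |w + T c| = 2. *)
Lemma sphere_isometry_center (C : set X) (c0 : X) (cs : seq X) :
  convex_set C -> C `<=` @unit_sphere R X -> C c0 ->
  (forall c, c \in cs -> C c) ->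
  exists m w, [/\ unit_sphere m, unit_sphere w &
    forall c, c \in cs -> [/\ slope_le m (- c) (- 1),
      slope_le w (- T c) (- 1) & slope_le w (T (- c)) (- 1)]].
Proof.
move=> cC CS Cc0 Ccs; have [m Cm mcs] := convex_set_center cC CS Cc0 Ccs.
have [U [UI UT]] := sphere_isometry_inv TI.
have mS := CS _ Cm; have TmS := sphere_isometry_sphere TI mS.
have starT c w : c \in cs -> unit_sphere w -> 2 <= `|w + T m| -> 2 <= `|w + T c|.
  move=> ccs wS wm; have cS := CS _ (Ccs _ ccs).
  have [z zS Tz] : (T @` @unit_sphere R X) (- w).
    by rewrite TI.1 /unit_sphere/= normrN.
  rewrite -[w]opprK -Tz addrC TI.2// addrC.
  apply: slope_le_star (mcs _ ccs) _ _; first by rewrite normrN zS.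
  by rewrite addrC -TI.2// Tz opprK addrC.
have starTN c w : c \in cs -> unit_sphere w -> 2 <= `|w + T m| ->
    2 <= `|w - T (- c)|.
  move=> ccs wS wm; have cS := CS _ (Ccs _ ccs).
  have := sphere_isometry_star UI wS (sphere_isometry_sphere TI cS)
    (starT _ _ ccs wS wm).
  have NcS : unit_sphere (- c) by rewrite /unit_sphere/= normrN.
  rewrite UT// -{1}[c]opprK -[in U w - _](UT (- c))// UI.2//.
  exact: sphere_isometry_sphere.
have [|w [wS _ ws]] := @star_center _ _ (T m)
    (map T cs ++ [seq - T (- c) | c <- cs]) TmS.
  move=> a; rewrite mem_cat => /orP[]/mapP[c ccs ->].
    split; first exact: sphere_isometry_sphere TI (CS _ (Ccs _ ccs)).
    by move=> w wS; exact: starT.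
  split; last by move=> w wS; exact: starTN.
  rewrite /unit_sphere/= normrN; apply: sphere_isometry_sphere TI _.
  by rewrite /unit_sphere/= normrN; exact: CS (Ccs _ ccs).
exists m, w; split=> // c ccs; split; first exact: mcs.
  by apply: ws; rewrite mem_cat map_f.
rewrite -[T _]opprK; apply: ws; rewrite mem_cat; apply/orP; right.
exact: (map_f (fun c => - T (- c))).
Qed.

(** For a unit vector u the number a is 1 - |u - c|, with c and c' in C such that
    |u - c| + |u + c'| <= 2 + d. The upper bounds for the slopes along - u and
    along u come from the neighbours - c and - c' of - u and u, at which the
    slopes are at most - 1; distances to them are preserved by T. *)
Lemma homogeneous_extension_slopes (C : set X) (c0 : X) (xs : seq X) (d : R) :
  convex_set C -> C `<=` @unit_sphere R X -> C c0 ->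
  (forall y, unit_sphere y -> exists c c',
     [/\ C c, C c' & `|y - c| + `|y + c'| <= 2 + d]) ->
  exists m w, [/\ unit_sphere m, unit_sphere w, slope_le w (- T c0) (- 1) &
    forall x, x \in xs -> exists a : R,
      [/\ slope_le m x (a + d * `|x|), slope_le m (- x) (- a),
          slope_le w (F x) (a + d * `|x|) & slope_le w (- F x) (- a)]].
Proof.
move=> cC CS Cc0 lush.
have /choice[p pP] (x : X) : exists p : X * X, [/\ C p.1, C p.2 & x != 0 ->
    `| `|x|^-1 *: x - p.1| + `| `|x|^-1 *: x + p.2| <= 2 + d].
  have [->|x0] := eqVneq x 0; first by exists (c0, c0).
  have [c [c' [Cc Cc' cc']]] := lush _ (normr_normalize x0).
  by exists (c, c').
(* p x is the pair (c, c') attached to the direction of x. *)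
pose cs := c0 :: [seq (p x).1 | x <- xs] ++ [seq (p x).2 | x <- xs].
have Ccs c : c \in cs -> C c.
  rewrite inE => /orP[/eqP->//|]; rewrite mem_cat => /orP[]/mapP[x _ ->];
  by have [] := pP x.
have [m [w [mS wS mw]]] := sphere_isometry_center cC CS Cc0 Ccs.
have [_ wc0 _] := mw _ (mem_head _ _).
exists m, w; split=> // x xxs.
have [x0|x0] := eqVneq x 0.
  have F0 : F x = 0 by rewrite x0 /F /homogeneous_extension normr0 scale0r.
  have slope0 (Z : normedModType R) (v : Z) : slope_le v 0 0.
    by have := slope_le_norm v 0; rewrite normr0.
  by exists 0; rewrite F0 x0 normr0 mulr0 addr0 !oppr0; split.
have [Cc Cc' /(_ x0)] := pP x; move: Cc Cc'.
have [] : (p x).1 \in cs /\ (p x).2 \in cs.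
  rewrite !inE !mem_cat (map_f (fun x => (p x).1) xxs).
  by rewrite (map_f (fun x => (p x).2) xxs) !orbT.
move: (p x) => [/= c c'] /mw[mc wc _] /mw[mc' _ wc'] Cc Cc'.
pose u := `|x|^-1 *: x; rewrite -/u => ucc'.
have uS : unit_sphere u by exact: normr_normalize.
have xu : x = `|x| *: u by rewrite scalerA mulfV ?normr_eq0// scale1r.
have Fu : F x = `|x| *: T u by [].
have NcS : unit_sphere (- c') by rewrite /unit_sphere/= normrN; exact: CS.
exists (`|x| * (1 - `|u - c|)).
have -> : `|x| * (1 - `|u - c|) + d * `|x| = `|x| * (1 - `|u - c| + d) by ring.
have bound : -1 + `|u + c'| <= 1 - `|u - c| + d by lra.
have bound' : -1 + `|u - c| <= - (1 - `|u - c|) by lra.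
rewrite Fu -!mulrN -scalerN; split.
- rewrite {1}xu; apply: slope_leZ => //; apply: slope_leW bound _.
  by have := slope_le_dist u mc'; rewrite opprK.
- rewrite {1}xu -scalerN; apply: slope_leZ => //; apply: slope_leW bound' _.
  by have := slope_le_dist (- u) mc; rewrite opprK [- u + _]addrC distrC.
- apply: slope_leZ => //; apply: slope_leW bound _.
  by have := slope_le_dist (T u) wc'; rewrite TI.2// opprK.
- apply: slope_leZ => //; apply: slope_leW bound' _.
  have := slope_le_dist (- T u) wc; rewrite opprK [- T u + _]addrC TI.2 ?(distrC c u)//.
  exact: CS.
Qed.

(** If F z := F (x + y) - (F x + F y) were not 0, its slope at w would be at most
    d (|x| + |y| + |x + y|) <= |z| / 8, while the slope along - F z is at most
    - |z| / 2 when C comes within 1 / 2 of z / |z|; but opposite vectors have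
    slopes of nonnegative sum. *)
Lemma homogeneous_extensionD x y : facially_lush X -> F (x + y) = F x + F y.
Proof.
move=> lush; apply: contrapT => /eqP; rewrite -subr_eq0.
have [z Fz] := homogeneous_extension_surj (F (x + y) - (F x + F y)).
rewrite -Fz => Fz0.
have z0 : z != 0 by rewrite -normr_eq0 -norm_homogeneous_extension normr_eq0.
pose u := `|z|^-1 *: z; have uS : unit_sphere u by exact: normr_normalize.
have half0 : 0 < 2^-1 :> R by [].
have [C [cC CS [c0 Cc0 uc0] {}lush]] := lush u 2^-1 uS half0.
pose M := `|x| + `|y| + `|x + y|.
have M0 : 0 <= M by rewrite !addr_ge0.
have zpos : 0 < `|z| by rewrite normr_gt0.
pose d := `|z| / 8 / (M + 1).
have d0 : 0 < d by rewrite !divr_gt0// ltr_wpDl.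
have dM : d * M <= `|z| / 8.
  rewrite /d mulrAC ler_pdivrMr ?ltr_wpDl// ler_wpM2l ?divr_ge0//; lra.
have [m [w [mS wS wc0 xs]]] := @homogeneous_extension_slopes C c0
  [:: x; y; x + y] d cC CS Cc0 (fun y yS => lush y d yS d0).
have [|a [mx _ _ wx]] := xs x; first by rewrite !inE eqxx.
have [|b [my _ _ wy]] := xs y; first by rewrite !inE eqxx orbT.
have [|e [_ mxy wxy _]] := xs (x + y); first by rewrite !inE eqxx !orbT.
(* The vectors - (x + y), x and y sum to 0 in X, whence e <= a + b up to the
   error terms. *)
have /(slope_le0 mS) eab : slope_le m 0 (- e + ((a + d * `|x|) + (b + d * `|y|))).
  by have := slope_leD mxy (slope_leD mx my); rewrite addNr.
have wz : slope_le w (F z) ((e + d * `|x + y|) + (- a + - b)).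
  by rewrite Fz opprD; apply: slope_leD => //; exact: slope_leD.
have wNz : slope_le w (- F z) (`|z| * (- 2^-1)).
  have -> : - F z = `|z| *: - T u by rewrite scalerN.
  apply: slope_leZ => //; apply: slope_leW (slope_le_dist _ wc0).
  have : `|- T u - - T c0| <= 2^-1.
    by rewrite opprK addrC TI.2 ?(distrC c0)//; exact: CS.
  lra.
have := slope_leD wz wNz; rewrite subrr => /(slope_le0 wS).
rewrite /M !mulrDr in dM; lra.
Qed.

End Extension.

Lemma facially_lush_Mazur_Ulam (R : realType) (X : completeNormedModType R) :
  facially_lush X -> Mazur_Ulam_property X.
Proof.
move=> lush Y T TS Tiso; have TI : sphere_isometry T by [].
pose F := homogeneous_extension T.
have FD x y : F (x + y) = F x + F y by exact: homogeneous_extensionD.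
have FN x : F (- x) = - F x.
  apply/eqP; rewrite -addr_eq0 -FD addNr -normr_eq0 norm_homogeneous_extension//.
  by rewrite normr0.
have FZ (k : R) x : 0 <= k -> F (k *: x) = k *: F x.
  exact: homogeneous_extensionZ.
have linF : linear F.
  move=> k x y; rewrite FD; congr (_ + _).
  have [k0|/ltW k0] := leP 0 k; first exact: FZ.
  by rewrite -[k]opprK scaleNr FN FZ ?oppr_ge0// [RHS]scaleNr.
pose L : {linear X -> Y} := HB.pack F (GRing.isLinear.Build R X Y *:%R F linF).
exists L; split.
- exact: norm_homogeneous_extension.
- by move=> y _; have [x <-] := homogeneous_extension_surj TI y; exists x.
- by move=> x xS; rewrite -homogeneous_extension_sphere.
Qed.

(** * Sums of spaces: the supremum norm *)

Section C0SumLush.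
Context {R : realType} {I : choiceType} {X : I -> completeNormedModType R}.
Implicit Types x y : c0_sum X.

(** The range of the coordinate norms has to be shown bounded, as the supremum
    of an unbounded set is 0 by convention. *)
Lemma c0_coord_le x i : `|c0_val x i| <= `|x|.
Proof.
rewrite leNgt; apply/negP => xi.
pose e := `|c0_val x i|.
have e0 : 0 < e by rewrite (le_lt_trans _ xi).
have fin : finite_set [set j | e <= `|c0_val x j|] by have /asboolP := c0_valP x; apply.
have ub : has_ubound (range (fun j => `|c0_val x j|)).
  exists (e + \sum_(j <- fset_set [set j | e <= `|c0_val x j|]) `|c0_val x j|).
  move=> _ [j _ <-].
  have [xj|/ltW xj] := leP e `|c0_val x j|; last first.
    by rewrite (le_trans xj)// lerDl sumr_ge0.
  have jJ : j \in fset_set [set j | e <= `|c0_val x j|] by rewrite in_fset_set// inE.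
  by rewrite (big_fsetD1 j)//= addrCA lerDl addr_ge0 ?(ltW e0)// big_seq sumr_ge0.
by move: xi; rewrite ltNge => /negP; apply; apply: ub_le_sup => //; exists i.
Qed.

Lemma c0_norm_le x (M : R) : 0 <= M -> (forall i, `|c0_val x i| <= M) -> `|x| <= M.
Proof.
move=> M0 xM; have [[i _]|I0] := pselect (exists i : I, True).
  by apply: ge_sup => [|_ [j _ <-]//]; exists `|c0_val x i|, i.
rewrite (_ : x = 0) ?normr0//; apply/val_inj/functional_extensionality_dep => i.
by exfalso; apply: I0; exists i.
Qed.

Lemma c0_update x i (c : X i) :
  exists2 y : c0_sum X, c0_val y i = c & forall j, j != i -> c0_val y j = c0_val x j.
Proof.
suff yc : (eqtype.dfwith (c0_val x) c : Defs.family X) \in c0_pred (X := X).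
  exists (C0Sum yc) => [|j ji] /=; first by rewrite eqtype.dfwith_in.
  by rewrite eqtype.dfwith_out// eq_sym.
apply/asboolP => e e0; apply: (@sub_finite_set _ _
    ([set i] `|` [set j | e <= `|c0_val x j|])) => [j /=|].
  have [->|ji] := eqVneq j i; first by left.
  by rewrite eqtype.dfwith_out 1?eq_sym//; right.
by rewrite finite_setU; split=> //; have /asboolP := c0_valP x; apply.
Qed.

(** Let x_i be a coordinate of x of almost maximal norm and C a large subset of
    the sphere of X_i close to x_i. Neighbours of y in the pulled back set D are
    obtained by changing the i-th coordinate only, so that distances are those
    computed in X_i. *)
Lemma c0_sum_facially_lush :
  (forall i, facially_lush (X i)) -> facially_lush (c0_sum X).
Proof.
move=> lush x e xS e0.
pose h := Num.min (e / 2) 2^-1.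
have h0 : 0 < h by rewrite lt_min divr_gt0//= invr_gt0.
have he : h + h <= e by have : h <= e / 2 by [rewrite ge_min lexx]; lra.
have h1 : h <= 2^-1 by rewrite ge_min lexx orbT.
have [i xi] : exists i, 1 - h <= `|c0_val x i|.
  apply: contrapT => /forallNP xh; have : `|x| <= 1 - h.
    apply: c0_norm_le => [|i]; first lra.
    by have /negP := xh i; rewrite -ltNge => /ltW.
  by rewrite xS; lra.
have xi1 : `|c0_val x i| <= 1 by rewrite -xS c0_coord_le.
have xi0 : c0_val x i != 0 by rewrite -normr_gt0; lra.
have [C [cC CS [c Cc xc]]] := lush i _ h (normr_normalize xi0) h0.
move=> /(facially_lush_ball CS Cc) {}lush.
pose D := [set z : c0_sum X | `|z| <= 1 /\ C (c0_val z i)].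
(* Only s = 1 and s = -1 occur: z agrees with - s y away from i. *)
have update (y : c0_sum X) v (s : R) : `|y| <= 1 -> C v -> `|s| = 1 ->
    exists2 z, D z & `|y + s *: z| = `|c0_val y i + s *: v|.
  move=> y1 Cv s1; have ss : s * s = 1.
    by rewrite -expr2 -real_normK ?num_real// s1 expr1n.
  have [z zi zj] := c0_update (- s *: y) v.
  have vS := CS _ Cv.
  exists z.
    split; last by rewrite zi.
    apply: c0_norm_le => // j; have [->|ji] := eqVneq j i; first by rewrite zi vS.
    rewrite zj// c0_valZ normrZ normrN s1 mul1r (le_trans _ y1)//.
    exact: c0_coord_le.
  apply/eqP; rewrite eq_le; apply/andP; split; last first.
    by rewrite -zi -c0_valZ -c0_valD c0_coord_le.
  apply: c0_norm_le => // j; rewrite c0_valD c0_valZ.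
  have [->|ji] := eqVneq j i; first by rewrite zi.
  by rewrite zj// c0_valZ scalerA mulrN ss scaleN1r subrr normr0.
exists D; split.
- apply/convex_setE => y z a b [y1 Cy] [z1 Cz] a0 b0 ab1; split.
    rewrite (le_trans (ler_normD _ _))// !normrZ !ger0_norm//.
    by rewrite -ab1 lerD// ler_piMr.
  by rewrite c0_valD !c0_valZ; move/convex_setE : cC; apply.
- move=> z [z1 Cz]; apply/eqP; rewrite eq_le z1 -(CS _ Cz).
  exact: c0_coord_le.
- have [||z Dz xz] := update x c (- 1) _ Cc; rewrite ?xS ?normrN1//.
  exists z => //; move: xz; rewrite !scaleN1r => ->.
  set t := `|c0_val x i| in xi xi1 xi0 xc *.
  apply: le_trans he; rewrite -(subrKA (t^-1 *: c0_val x i)).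
  rewrite (le_trans (ler_normD _ _))// lerD//.
  have t0 : t != 0 by rewrite normr_eq0.
  rewrite -{1}[c0_val x i]scale1r -scalerBl normrZ -/t -{2}[t]normr_id -normrM.
  rewrite mulrBl mul1r mulVf// distrC ger0_norm ?subr_ge0//; move: xi; rewrite /t; lra.
- move=> y d yS d0.
  have [|c1 [c2 [Cc1 Cc2 cc]]] := lush (c0_val y i) d _ d0.
    by rewrite -yS c0_coord_le.
  have [||z Dz yz] := update y c1 (- 1) _ Cc1; rewrite ?yS ?normrN1//.
  have [||z' Dz' yz'] := update y c2 1 _ Cc2; rewrite ?yS ?normr1//.
  exists z, z'; split=> //; move: yz yz'; rewrite !scaleN1r !scale1r => -> ->.
  by [].
Qed.

End C0SumLush.

(** * Sums of spaces: the summation norm *)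

Section RayCone.
Context {R : realType} {Z : normedModType R}.
Implicit Types (C : set Z) (k y : Z).

Definition ray_cone C : set Z := [set k | k != 0 -> C (`|k|^-1 *: k)].

Lemma ray_coneZ C k (r : R) : 0 <= r -> ray_cone C k -> ray_cone C (r *: k).
Proof.
move=> r0 Ck; rewrite /ray_cone/= scaler_eq0 negb_or => /andP[rn0 /Ck {}Ck].
by rewrite normrZ ger0_norm// scalerA invfM mulrAC mulVf// mul1r.
Qed.

(** The norm is additive on the cone because a normalised sum of two of its
    vectors is a convex combination of points of C, of norm 1. *)
Lemma ray_coneD C k l : convex_set C -> C `<=` @unit_sphere R Z ->
  ray_cone C k -> ray_cone C l -> ray_cone C (k + l) /\ `|k + l| = `|k| + `|l|.
Proof.
move=> /convex_setE cC CS.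
have [->|k0] := eqVneq k 0; first by rewrite add0r normr0 add0r.
have [->|l0] := eqVneq l 0; first by rewrite addr0 normr0 addr0.
move=> /(_ k0) Ck /(_ l0) Cl.
have kl0 : 0 < `|k| + `|l| by rewrite addr_gt0 ?normr_gt0.
have Ckl : C ((`|k| + `|l|)^-1 *: (k + l)).
  have unscale v (s : R) : v != 0 -> (`|v| / s) *: (`|v|^-1 *: v) = s^-1 *: v.
    by move=> v0; rewrite scalerA mulrAC mulfV ?normr_eq0// mul1r.
  have := cC _ _ (`|k| / (`|k| + `|l|)) (`|l| / (`|k| + `|l|)) Ck Cl.
  rewrite !unscale// -scalerDr.
  by apply; rewrite ?divr_ge0 ?(ltW kl0)// -mulrDl mulfV ?gt_eqF.
have klE : `|k + l| = `|k| + `|l|.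
  have := CS _ Ckl; rewrite /unit_sphere/= normrZ gtr0_norm ?invr_gt0// => kl1.
  by rewrite -[RHS]mulr1 -kl1 mulrA mulfV ?mul1r// gt_eqF.
by split=> // _; rewrite klE.
Qed.

(** Homogeneous form of facial lushness, which applies to coordinates of
    arbitrary norm, including 0 and including coordinates in the trivial space,
    where C is empty and its cone is {0}. *)
Lemma facially_lush_cone k (e : R) : facially_lush Z -> 0 < e -> exists C,
  [/\ convex_set C, C `<=` @unit_sphere R Z,
      exists l, [/\ ray_cone C l, `|l| = `|k| & `|k - l| <= e * `|k|] &
      forall y (d : R), 0 < d -> exists l l', [/\ ray_cone C l /\ ray_cone C l',
        `|l| = `|y|, `|l'| = `|y| & `|y - l| + `|y + l'| <= (2 + d) * `|y|]].
Proof.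
move=> lush e0.
(* u is the direction used to choose C: k itself unless it is 0. *)
have [u [u0 ku]] : exists u : Z, (u = 0 -> forall y : Z, y = 0) /\ (k != 0 -> u = k).
  have [k0|k0] := eqVneq k 0; last by exists k; split=> // k0'; rewrite k0' eqxx in k0.
  have [[u un0]|Z0] := pselect (exists u : Z, u != 0).
    by exists u; split=> // uE; rewrite uE eqxx in un0.
  exists 0; split=> // _ y; apply/eqP/negP => /negP yn0.
  by apply: Z0; exists y.
have [uE|un0] := eqVneq u 0.
  have all0 := u0 uE; have norm0 (y : Z) : `|y| = 0 by rewrite (all0 y) normr0.
  exists set0; split=> //.
  - exists 0; split; rewrite ?normr0 ?(all0 k) ?subrr ?normr0 ?mulr0//.
    by rewrite /ray_cone/= eqxx.
  - move=> y d d0; exists 0, 0; rewrite !norm0 mulr0 addr0; split=> //.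
    by rewrite /ray_cone/= eqxx.
have scale_ray C (c y : Z) : C `<=` @unit_sphere R Z -> C c ->
    ray_cone C (`|y| *: c) /\ `| `|y| *: c| = `|y|.
  move=> CS Cc; split; last by rewrite normrZ normr_id (CS _ Cc) mulr1.
  by apply: ray_coneZ => // _; rewrite (CS _ Cc) invr1 scale1r.
have unscale (y : Z) : y != 0 -> `|y| *: (`|y|^-1 *: y) = y.
  by move=> yn0; rewrite scalerA mulfV ?normr_eq0// scale1r.
have [C [cC CS [c Cc uc] {}lush]] := lush _ e (normr_normalize un0) e0.
exists C; split=> //.
- exists (`|k| *: c); have [Ck nk] := scale_ray _ _ k CS Cc; split=> //.
  have [->|kn0] := eqVneq k 0; first by rewrite normr0 scale0r subrr normr0 mulr0.
  move: uc; rewrite ku// => uc.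
  by rewrite -{1}(unscale _ kn0) -scalerBr normrZ normr_id mulrC ler_wpM2r.
- move=> y d d0; have [->|yn0] := eqVneq y 0.
    exists 0, 0; rewrite subrr addr0 normr0 mulr0 addr0; split=> //.
    by rewrite /ray_cone/= eqxx.
  have [c1 [c2 [Cc1 Cc2 yc]]] := lush _ d (normr_normalize yn0) d0.
  have [Cy1 n1] := scale_ray _ _ y CS Cc1; have [Cy2 n2] := scale_ray _ _ y CS Cc2.
  exists (`|y| *: c1), (`|y| *: c2); split=> //.
  rewrite -{1 3}(unscale _ yn0) -scalerBr -scalerDr !normrZ !normr_id -mulrDr.
  by rewrite [_ * `|y|]mulrC ler_wpM2l.
Qed.

End RayCone.

Lemma pointwise_choice (I : Type) (T : I -> Type) (P : forall i, T i -> Prop) :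
  (forall i, exists t, P i t) -> exists f : forall i, T i, forall i, P i (f i).
Proof. by move=> H; exists (fun i => projT1 (cid (H i))) => i; case: cid. Qed.

Section L1SumLush.
Context {R : realType} {I : choiceType} {X : I -> completeNormedModType R}.
Implicit Types x y z : l1_sum X.

Lemma l1_norm_esum x : (`|x|)%:E = \esum_(i in [set: I]) `|l1_val x i|%:E.
Proof.
rewrite fineK// ge0_fin_numE ?esum_ge0//.
have : summable [set: I] (fun i => `|l1_val x i|%:E) := l1_valP x.
rewrite /summable; by under eq_esum do rewrite gee0_abs//.
Qed.

(** Two norms are compared at once because only the sum |y_i - c_i| + |y_i + c'_i|
    is controlled in each coordinate. *)
Lemma l1_norm_le2 x y z (M : R) : 0 <= M ->
  (forall i, `|l1_val x i| + `|l1_val y i| <= M * `|l1_val z i|) ->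
  `|x| + `|y| <= M * `|z|.
Proof.
move=> M0 xyz; rewrite -lee_fin EFinD EFinM !l1_norm_esum -esumD//.
rewrite -l1_norm_esum; apply: ge_ereal_sup => _ [A [fA _] <-].
rewrite fsbig_finite//= -EFinM.
apply: (@le_trans _ _ (\sum_(i <- fset_set A) (M * `|l1_val z i|)%:E)).
  by apply: lee_sum => i _; rewrite -EFinD lee_fin.
rewrite sumEFin -mulr_sumr lee_fin ler_wpM2l// -lee_fin l1_norm_esum.
apply: ereal_sup_ubound; exists A; first by split.
by rewrite fsbig_finite// sumEFin.
Qed.

Lemma l1_norm_le x z (M : R) : 0 <= M ->
  (forall i, `|l1_val x i| <= M * `|l1_val z i|) -> `|x| <= M * `|z|.
Proof.
move=> M0 xz; rewrite -[ `|x|]addr0 -(normr0 (l1_sum X)); apply: l1_norm_le2 => // i.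
by rewrite normr0 addr0.
Qed.

Lemma l1_same_norms x (k : forall i, X i) : (forall i, `|k i| = `|l1_val x i|) ->
  exists2 z, (forall i, l1_val z i = k i) & `|z| = `|x|.
Proof.
move=> kx; have kl : (k : Defs.family X) \in l1_pred (X := X).
  have /l1_predPfset[M xM] := l1_valP x; apply/l1_predPfset; exists M => J.
  by rewrite (eq_bigr _ (fun i _ => kx i)).
exists (L1Sum kl) => //; apply: EFin_inj; rewrite !l1_norm_esum.
by apply: eq_esum => i _; rewrite kx.
Qed.

(** The set D is convex because the norm is additive on the cone over each C_i,
    hence on D. Neighbours of x and y in D are built coordinatewise, with errors
    proportional to |x_i| and |y_i|, which are summable. *)
Lemma l1_sum_facially_lush :
  (forall i, facially_lush (X i)) -> facially_lush (l1_sum X).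
Proof.
move=> lush x e xS e0.
have [C CP] := pointwise_choice (fun i => facially_lush_cone (l1_val x i) (lush i) e0).
pose D := [set z : l1_sum X | `|z| = 1 /\ forall i, ray_cone (C i) (l1_val z i)].
exists D; split.
- apply/convex_setE => y z a b [yS Cy] [zS Cz] a0 b0 ab1.
  have CD i : ray_cone (C i) (l1_val (a *: y + b *: z) i) /\
      `|l1_val (a *: y + b *: z) i| = `|l1_val (a *: y) i| + `|l1_val (b *: z) i|.
    have [cC CS _ _] := CP i.
    by rewrite l1_valD; apply: ray_coneD => //; apply: ray_coneZ.
  split; last by move=> i; have [] := CD i.
  apply/eqP; rewrite eq_le; apply/andP; split.
    by rewrite (le_trans (ler_normD _ _))// !normrZ !ger0_norm// yS zS !mulr1 ab1.
  rewrite -[leRHS]mul1r.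
  apply: le_trans (l1_norm_le2 ler01 (x := a *: y) (y := b *: z) _).
    by rewrite !normrZ !ger0_norm// yS zS !mulr1 ab1.
  by move=> i; rewrite mul1r; have [_ ->] := CD i.
- by move=> z [].
- have /pointwise_choice[k kP] i : exists k, [/\ ray_cone (C i) k,
      `|k| = `|l1_val x i| & `|l1_val x i - k| <= e * `|l1_val x i|].
    by have [] := CP i.
  have [|c ck c1] := @l1_same_norms x k; first by move=> i; have [] := kP i.
  exists c; first by split; [rewrite c1|move=> i; rewrite ck; have [] := kP i].
  rewrite -[e]mulr1 -[X in _ <= _ * X]xS; apply: l1_norm_le => [|i]; first exact: ltW.
  by rewrite l1_valD l1_valN ck; have [] := kP i.
- move=> y d yS d0.
  have /pointwise_choice[l] i : exists l l',
      [/\ ray_cone (C i) l /\ ray_cone (C i) l', `|l| = `|l1_val y i|,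
        `|l'| = `|l1_val y i| &
        `|l1_val y i - l| + `|l1_val y i + l'| <= (2 + d) * `|l1_val y i|].
    by have [_ _ _] := CP i; apply.
  move=> /pointwise_choice[l' lP].
  have [|c cl c1] := @l1_same_norms y l; first by move=> i; have [] := lP i.
  have [|c' cl' c'1] := @l1_same_norms y l'; first by move=> i; have [] := lP i.
  exists c, c'; split.
  + by split; [rewrite c1|move=> i; rewrite cl; have [[]] := lP i].
  + by split; [rewrite c'1|move=> i; rewrite cl'; have [[]] := lP i].
  rewrite -[2 + d]mulr1 -[X in _ <= _ * X]yS; apply: l1_norm_le2 => [|i].
    by rewrite addr_ge0// ltW.
  by rewrite !l1_valD l1_valN cl cl'; have [] := lP i.
Qed.

End L1SumLush.

(** * The Mazur-Ulam property of the sums *)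

Theorem proposition2p13 (R : realType) (I : choiceType)
    (X : I -> completeNormedModType R)
    (X_separable : forall i, separable (X i))
    (X_almost_CL : forall i, almost_CL_space (X i)) :
  Mazur_Ulam_property (c0_sum X) /\ Mazur_Ulam_property (l1_sum X).
Proof.
have lush i : facially_lush (X i) by exact: almost_CL_facially_lush.
split; apply: facially_lush_Mazur_Ulam.
  exact: c0_sum_facially_lush.
exact: l1_sum_facially_lush.
Qed.
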